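(* Suppose that $f(x,y)$ is concave and $g(x,y)$ is convex in the variable $y$ for all $x\in X$, and that $f,g$ are twice continuously differentiable. Let $\bar x\in\mathrm{int}\,X$ be a local minimum of the problem $\min_{x\in X}V(x)$ and $\bar y\in\mathcal S(\bar x)$. Suppose that the KKT condition holds for the problem $\max_y\{f(\bar x,y):g(\bar x,y)\le0\}$ at $\bar y$ with a multiplier $\bar\lambda$ (i.e. $\bar\lambda\in\Sigma(\bar x,\bar y)$), and that a CQ holds at $(\bar x,\bar y,\bar\lambda)$ for the constraint system in $(x,y,\lambda)$ $$\nabla_y\mathcal L(x,y,\lambda)=0,\quad\lambda\ge0.$$ Then there exists a vector $\bar u$ such that $$\nabla_x\mathcal L(\bar x,\bar y,\bar\lambda)+\nabla_{xy}^2\mathcal L(\bar x,\bar y,\bar\lambda)\bar u=0,$$ $$\nabla_{yy}^2\mathcal L(\bar x,\bar y,\bar\lambda)\bar u=0,\qquad \nabla_y\mathcal L(\bar x,\bar y,\bar\lambda)=0,$$ $$0\le-\nabla_yg(\bar x,\bar y)^\top\bar u-g(\bar x,\bar y)\perp\bar\lambda\ge0,\qquad 0\le-g(\bar x,\bar y)\perp\bar\lambda\ge0.$$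
   Context: $f:\mathbb R^{n+m}\to\mathbb R$, $g:\mathbb R^{n+m}\to\mathbb R^q$, and $X\subseteq\mathbb R^n$ is closed. For $x\in\mathbb R^n$ let $\mathcal F(x)=\{y\in\mathbb R^m:g(x,y)\le0\}$, $V(x)=\sup\{f(x,y):y\in\mathcal F(x)\}$ ($=-\infty$ if $\mathcal F(x)=\emptyset$), $\mathcal S(x)=\{y\in\mathcal F(x):f(x,y)=V(x)\}$. For a vector-valued map, $\nabla$ is the transposed Jacobian (so $\nabla_yg\in\mathbb R^{m\times q}$). $\mathcal L(x,y,\lambda)=f(x,y)-g(x,y)^\top\lambda$; $\nabla^2_{xy}\mathcal L\in\mathbb R^{n\times m}$, with $\nabla_{xy}^2\mathcal L\,u=\nabla_x(u^\top\nabla_y\mathcal L)$. $\Sigma(x,y)=\{\lambda:\nabla_y\mathcal L(x,y,\lambda)=0,\ 0\le-g(x,y)\perp\lambda\ge0\}$. A constraint qualification (CQ) at a feasible point $\bar z$ of a system $G(z)\le0,\ H(z)=0$ ($G,H$ continuously differentiable) is a condition on the system ensuring that whenever $\bar z$ is a local minimizer over the feasible set of a continuously differentiable function $\varphi$, the KKT conditions hold: there are $a\ge0$, $b$ with $a\perp G(\bar z)$ and $\nabla\varphi(\bar z)+\nabla G(\bar z)a+\nabla H(\bar z)b=0$. *)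

(* Defs.v *)
From HB Require Import structures.
From mathcomp Require Import all_boot all_order all_algebra.
From mathcomp Require Import all_classical all_reals all_analysis.

Set Implicit Arguments.
Unset Strict Implicit.
Unset Printing Implicit Defensive.

Import Order.TTheory GRing.Theory Num.Theory.
Import numFieldNormedType.Exports.

Local Open Scope classical_set_scope.
Local Open Scope ring_scope.

(* Points of R^N are column vectors; (x, y) in R^(n+m) is [col_mx x y]. *)

Section Vectors.
Variable R : realType.

Definition dot p (a b : 'cV[R]_p) : R := (a^T *m b) 0 0.

Definition nonneg p (a : 'cV[R]_p) : Prop := forall i, 0 <= a i 0.

(* 0 <= a _|_ b >= 0 *)
Definition complementary p (a b : 'cV[R]_p) : Prop :=
  [/\ nonneg a, dot a b = 0 & nonneg b].

End Vectors.

Section Calculus.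
Variable R : realType.

Definition grad N (phi : 'cV[R]_N -> R) (z : 'cV[R]_N) : 'cV[R]_N :=
  \col_i 'D_(delta_mx i 0) phi z.

(* The transposed Jacobian: column j is the gradient of the j-th component. *)
Definition nabla N q (F : 'cV[R]_N -> 'cV[R]_q) (z : 'cV[R]_N) : 'M[R]_(N, q) :=
  \matrix_(i, j) 'D_(delta_mx i 0) (fun w => F w j 0 : R) z.

Definition C1 N (phi : 'cV[R]_N -> R) : Prop :=
  (forall z, differentiable phi z) /\ continuous (grad phi).

Definition C1map N q (F : 'cV[R]_N -> 'cV[R]_q) : Prop :=
  forall j, C1 (fun z => F z j 0).

Definition C2 N (phi : 'cV[R]_N -> R) : Prop := C1 phi /\ C1map (grad phi).

Definition C2map N q (F : 'cV[R]_N -> 'cV[R]_q) : Prop :=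
  forall j, C2 (fun z => F z j 0).

Definition convex_fun m (h : 'cV[R]_m -> R) : Prop :=
  @convex_function R 'cV[R]_m setT h.

Definition concave_fun m (h : 'cV[R]_m -> R) : Prop :=
  convex_fun (fun y => - h y).

End Calculus.

(* Stated for an arbitrary ordered codomain: the objective is real-valued in
   the KKT conditions, but the value function V takes values in \bar R. *)
Definition local_min (T : topologicalType) (d : Order.disp_t) (E : porderType d)
    (A : set T) (phi : T -> E) (z : T) : Prop :=
  A z /\ \forall w \near z, A w -> (phi z <= phi w)%O.

Section ConstraintSystems.
Variable R : realType.

Definition feasible N p r (G : 'cV[R]_N -> 'cV[R]_p) (H : 'cV[R]_N -> 'cV[R]_r) :
    set 'cV[R]_N :=
  [set z | nonneg (- G z) /\ H z = 0].

Definition KKT N p r (G : 'cV[R]_N -> 'cV[R]_p) (H : 'cV[R]_N -> 'cV[R]_r)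
    (phi : 'cV[R]_N -> R) (z : 'cV[R]_N) : Prop :=
  exists (a : 'cV[R]_p) (b : 'cV[R]_r),
    [/\ nonneg a, dot a (G z) = 0 &
        grad phi z + nabla G z *m a + nabla H z *m b = 0].

(* A condition on a system G <= 0, H = 0 (of any size) and a point. *)
Definition system_condition : Type :=
  forall N p r : nat,
    ('cV[R]_N -> 'cV[R]_p) -> ('cV[R]_N -> 'cV[R]_r) -> 'cV[R]_N -> Prop.

Definition constraint_qualification (CQ : system_condition) : Prop :=
  forall (N p r : nat) (G : 'cV[R]_N -> 'cV[R]_p) (H : 'cV[R]_N -> 'cV[R]_r)
    (z : 'cV[R]_N),
    C1map G -> C1map H -> feasible G H z -> CQ N p r G H z ->
    forall phi : 'cV[R]_N -> R,
      C1 phi -> local_min (feasible G H) phi z -> KKT G H phi z.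

End ConstraintSystems.

Section MinMax.
Variables (R : realType) (n m q : nat).
Variables (f : 'cV[R]_(n + m) -> R) (g : 'cV[R]_(n + m) -> 'cV[R]_q).

Definition Fset (x : 'cV[R]_n) : set 'cV[R]_m :=
  [set y | nonneg (- g (col_mx x y))].

Definition V (x : 'cV[R]_n) : \bar R :=
  ereal_sup [set (f (col_mx x y))%:E | y in Fset x].

Definition Sset (x : 'cV[R]_n) : set 'cV[R]_m :=
  [set y | Fset x y /\ (f (col_mx x y))%:E = V x].

Definition Lagr (x : 'cV[R]_n) (y : 'cV[R]_m) (lam : 'cV[R]_q) : R :=
  f (col_mx x y) - dot (g (col_mx x y)) lam.

Definition nabla_x_L x y lam : 'cV[R]_n := grad (fun x' => Lagr x' y lam) x.

Definition nabla_y_L x y lam : 'cV[R]_m := grad (fun y' => Lagr x y' lam) y.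

(* In particular (nabla_xy_L x y lam) *m u is the gradient in x of
   dot u (nabla_y_L x y lam). *)
Definition nabla_xy_L x y lam : 'M[R]_(n, m) :=
  nabla (fun x' => nabla_y_L x' y lam) x.

Definition nabla_yy_L x y lam : 'M[R]_(m, m) :=
  nabla (fun y' => nabla_y_L x y' lam) y.

Definition nabla_y_g (x : 'cV[R]_n) (y : 'cV[R]_m) : 'M[R]_(m, q) :=
  nabla (fun y' => g (col_mx x y')) y.

Definition Sigma (x : 'cV[R]_n) (y : 'cV[R]_m) : set 'cV[R]_q :=
  [set lam | nabla_y_L x y lam = 0 /\ complementary (- g (col_mx x y)) lam].

(* The constraint system nabla_y L(x, y, lam) = 0, lam >= 0 in the variable
   z = (x, y, lam) = col_mx (col_mx x y) lam, in the form G <= 0, H = 0. *)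

Definition dualG (z : 'cV[R]_(n + m + q)) : 'cV[R]_q := - dsubmx z.

Definition dualH (z : 'cV[R]_(n + m + q)) : 'cV[R]_m :=
  nabla_y_L (usubmx (usubmx z)) (dsubmx (usubmx z)) (dsubmx z).

End MinMax.

(* Main.v *)
Require Import Defs.
From HB Require Import structures.
From mathcomp Require Import all_boot all_order all_algebra.
From mathcomp Require Import all_classical all_reals all_analysis.

Set Implicit Arguments.
Unset Strict Implicit.
Unset Printing Implicit Defensive.

Import Order.TTheory GRing.Theory Num.Theory.
Import numFieldNormedType.Exports.

Local Open Scope classical_set_scope.
Local Open Scope ring_scope.

(** The proof is Wolfe duality read through the constraint qualification.

    Fix [x] in [X].  If [lam >= 0] and [y] is a critical point of the Lagrangian
    [Lagr x _ lam], then [y] maximizes that function, because it is concave; so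
    [Lagr x y lam] bounds [Lagr x y' lam >= f (x, y')] for every feasible [y'],
    hence bounds [V x] ([weak_duality]).  At [(xb, yb, lamb)] the bound is
    attained, by complementarity and [f (xb, yb) = V xb].  Since [xb] is interior
    to [X] and minimizes [V] locally, any nearby feasible [(x, y, lam)] of the
    system [nabla_y L = 0, lam >= 0] satisfies
    [Lagr x y lam >= V x >= V xb = Lagr xb yb lamb], that is, [(xb, yb, lamb)] is
    a local minimizer of the Lagrangian over that system ([dual_local_min]).

    The constraint qualification then yields multipliers [a >= 0] for
    [- lam <= 0], with [a] orthogonal to [lamb], and [b] for [nabla_y L = 0].  The
    three blocks of the stationarity equation, computed in [grad_dual_objective],
    [nabla_dualH] and [nabla_dualG], are
      [nabla_x L + nabla_xy L b = 0],  [nabla_y L + nabla_yy L b = 0],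
      [- g - a - (nabla_y g)^T b = 0].
    Because [nabla_y L = 0], the second says [nabla_yy L b = 0]; the third
    identifies [a] with [- (nabla_y g)^T b - g], whose sign and orthogonality to
    [lamb] are the remaining claims.  So [b] is the required vector.

    What is left is calculus: the objective and the constraints of the system
    must be C1.  Both have the shape [F (x, y) - \sum_j G_j (x, y) * lam_j] with
    [F] and [G_j] of class C1 ([F = f], [G_j = g_j] for the objective, and their
    partial derivatives in [y] for the constraints), which one lemma,
    [C1_Lagrange_form], covers. *)

(** * Continuity of matrix-valued maps *)

Section MatrixTopology.
Variable R : realType.

Lemma continuous_coordwise (T : topologicalType) p r (F : T -> 'M[R]_(p, r)) :
  (forall i j, continuous (fun t => F t i j)) -> continuous F.
Proof.
move=> Fc t A [P FtP PA].
have : \forall s \near t, forall i j, P i j (F s i j).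
  apply: filter_forall => i; apply: filter_forall => j.
  exact: (Fc i j t _ (FtP i j)).
by apply: filterS => s Ps; exact: PA.
Qed.

Lemma continuous_usubmx p1 p2 r :
  continuous (usubmx : 'M[R]_(p1 + p2, r) -> 'M[R]_(p1, r)).
Proof.
apply: continuous_coordwise => i j.
under eq_fun do rewrite mxE.
exact: coord_continuous.
Qed.

Lemma continuous_sum (T : topologicalType) k (F : 'I_k -> T -> R) :
  (forall i, continuous (F i)) -> continuous (fun t => \sum_i F i t).
Proof.
by move=> Fc; apply: continuous_big => //; exact: add_continuous.
Qed.

Lemma continuous_mulmx p1 p2 r (A : 'M[R]_(p1, p2)) :
  continuous (mulmx A : 'M[R]_(p2, r) -> 'M[R]_(p1, r)).
Proof.
apply: continuous_coordwise => i j.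
under eq_fun do rewrite mxE.
apply: continuous_sum => k z.
apply: (@continuousM _ _ (fun=> A i k) (fun M : 'M[R]_(p2, r) => M k j)).
  exact: cst_continuous.
exact: coord_continuous.
Qed.

End MatrixTopology.

(** * Directional derivatives and block gradients *)

Section DirectionalDerivatives.
Variable R : realType.

(** When [phi] is affine along the line through [z] in the direction [v], the
    difference quotient is constant away from [0]. *)
Lemma derive_affine (U : normedModType R) (phi : U -> R) (z v : U) (d : R) :
  (forall h : R, phi (h *: v + z) = phi z + h * d) -> 'D_v phi z = d.
Proof.
move=> phiE; rewrite /derive; apply: lim_near_cst => //.
near=> h; rewrite /= phiE addrAC subrr add0r.
rewrite /GRing.scale/= mulKf//; near: h; exact: nbhs_dnbhs_neq.
Unshelve. all: by end_near. Qed.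

(** Freezing one block of variables leaves the very same difference quotients,
    so partial derivatives are directional derivatives of the whole function,
    without any chain rule. *)
Lemma derive_partialu a b (phi : 'cV[R]_(a + b) -> R) x y v :
  'D_v (fun x' => phi (col_mx x' y)) x = 'D_(col_mx v 0) phi (col_mx x y).
Proof.
rewrite /derive; set d1 := (fun h : R => _); set d2 := (fun h : R => _).
suff -> : d1 = d2 by []; apply/funext => h; rewrite /d1 /d2 /=.
by rewrite scale_col_mx add_col_mx scaler0 add0r.
Qed.

Lemma derive_partiald a b (phi : 'cV[R]_(a + b) -> R) x y v :
  'D_v (fun y' => phi (col_mx x y')) y = 'D_(col_mx 0 v) phi (col_mx x y).
Proof.
rewrite /derive; set d1 := (fun h : R => _); set d2 := (fun h : R => _).
suff -> : d1 = d2 by []; apply/funext => h; rewrite /d1 /d2 /=.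
by rewrite scale_col_mx add_col_mx scaler0 add0r.
Qed.

Lemma grad_col_mx a b (phi : 'cV[R]_(a + b) -> R) x y :
  grad phi (col_mx x y) =
  col_mx (grad (fun x' => phi (col_mx x' y)) x)
         (grad (fun y' => phi (col_mx x y')) y).
Proof.
apply/colP => k; case: (split_ordP k) => l ->.
  by rewrite col_mxEu !mxE derive_partialu delta_mx_ushift.
by rewrite col_mxEd !mxE derive_partiald delta_mx_dshift.
Qed.

Lemma nabla_grad N k (F : 'cV[R]_N -> 'cV[R]_k) z :
  nabla F z = \matrix_(i, j) grad (fun w => F w j 0) z i 0.
Proof. by apply/matrixP => i j; rewrite !mxE. Qed.

Lemma nabla_col_mx a b k (F : 'cV[R]_(a + b) -> 'cV[R]_k) x y :
  nabla F (col_mx x y) =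
  col_mx (nabla (fun x' => F (col_mx x' y)) x)
         (nabla (fun y' => F (col_mx x y')) y).
Proof.
apply/matrixP => i j; rewrite !nabla_grad mxE grad_col_mx.
by case: (split_ordP i) => l ->; rewrite ?col_mxEu ?col_mxEd !mxE.
Qed.

Lemma derive_grad N (phi : 'cV[R]_N -> R) z v :
  differentiable phi z -> 'D_v phi z = dot v (grad phi z).
Proof.
move=> dphi; rewrite deriveE// /dot mxE {1}[v]matrix_sum_delta linear_sum.
apply: eq_bigr => i _; rewrite big_ord1 linearZ/= !mxE deriveE//.
Qed.

End DirectionalDerivatives.

(** * Functions of class C1 *)

Section C1.
Variable R : realType.

Lemma C1_partials N (phi : 'cV[R]_N -> R) :
  (forall z, differentiable phi z) ->
  (forall i, continuous (fun z => grad phi z i 0)) -> C1 phi.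
Proof.
move=> dphi cphi; split=> //; apply: continuous_coordwise => i j.
by rewrite ord1; exact: cphi.
Qed.

Lemma C1_continuous N (phi : 'cV[R]_N -> R) : C1 phi -> continuous phi.
Proof. by move=> [dphi _] z; exact: differentiable_continuous. Qed.

Lemma C1_continuous_grad N (phi : 'cV[R]_N -> R) i :
  C1 phi -> continuous (fun z => grad phi z i 0).
Proof.
move=> [_ cphi] z.
exact: (@continuous_comp _ _ _ (grad phi) (fun M : 'cV[R]_N => M i 0) z
  (cphi z) (@coord_continuous _ _ _ _ _ _)).
Qed.

Lemma C1_const N (c : R) : C1 (fun _ : 'cV[R]_N => c).
Proof.
apply: C1_partials => [z|i]; first exact: differentiable_cst.
rewrite (_ : (fun z => grad _ z i 0) = cst 0); first exact: cst_continuous.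
by apply/funext => z; rewrite mxE derive_cst.
Qed.

Lemma C1_coord N k : C1 (fun z : 'cV[R]_N => z k 0).
Proof.
apply: C1_partials => [z|i]; first exact: differentiable_coord.
rewrite (_ : (fun z => grad _ z i 0) = cst ((k == i)%:R)); first exact: cst_continuous.
apply/funext => z; rewrite mxE; apply: derive_affine => h.
by rewrite !mxE eqxx andbT addrC.
Qed.

Lemma C1_add N (phi psi : 'cV[R]_N -> R) :
  C1 phi -> C1 psi -> C1 (fun z => phi z + psi z).
Proof.
move=> phi1 psi1; have [dphi _] := phi1; have [dpsi _] := psi1.
apply: C1_partials => [z|i]; first exact: differentiableD.
rewrite (_ : (fun z => grad _ z i 0) =
    (fun z => grad phi z i 0) + (fun z => grad psi z i 0)).
  move=> z; apply: continuousD; exact: C1_continuous_grad.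
apply/funext => z; rewrite fctE !mxE deriveD//; exact: diff_derivable.
Qed.

Lemma C1_mul N (phi psi : 'cV[R]_N -> R) :
  C1 phi -> C1 psi -> C1 (fun z => phi z * psi z).
Proof.
move=> phi1 psi1; have [dphi _] := phi1; have [dpsi _] := psi1.
apply: C1_partials => [z|i]; first exact: differentiableM.
rewrite (_ : (fun z => grad _ z i 0) = (phi \* (fun z => grad psi z i 0))
    + (psi \* (fun z => grad phi z i 0))).
  move=> z; apply: continuousD.
    exact: (continuousM (@C1_continuous N phi phi1 z)
      (@C1_continuous_grad N psi i psi1 z)).
  exact: (continuousM (@C1_continuous N psi psi1 z)
      (@C1_continuous_grad N phi i phi1 z)).
apply/funext => z; rewrite fctE /= !mxE -[LHS]/('D_(delta_mx i 0) (phi * psi) z).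
by rewrite deriveM//; exact: diff_derivable.
Qed.

Lemma C1_opp N (phi : 'cV[R]_N -> R) : C1 phi -> C1 (fun z => - phi z).
Proof.
move=> phi1; rewrite (_ : (fun z => _) = (fun z => (-1) * phi z)).
  exact: (C1_mul (C1_const N (-1)) phi1).
by apply/funext => z; rewrite mulN1r.
Qed.

Lemma C1_sum N k (F : 'I_k -> 'cV[R]_N -> R) :
  (forall j, C1 (F j)) -> C1 (fun z => \sum_j F j z).
Proof.
move=> F1; rewrite (_ : (fun z => _) = \sum_j F j); last first.
  by rewrite fct_sumE.
apply: (@big_ind _ (fun phi : 'cV[R]_N -> R => C1 phi)).
- exact: C1_const.
- exact: C1_add.
- by move=> j _; exact: F1.
Qed.

Lemma C1_usubmx a b (phi : 'cV[R]_a -> R) :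
  C1 phi -> C1 (fun z : 'cV[R]_(a + b) => phi (usubmx z)).
Proof.
move=> phi1; have [dphi _] := phi1; apply: C1_partials => [z|i].
  apply: (@differentiable_comp _ _ _ _ (usubmx : 'cV[R]_(a + b) -> 'cV[R]_a)).
    exact/linear_differentiable/continuous_usubmx.
  exact: dphi.
have gradE z : grad (fun z : 'cV[R]_(a + b) => phi (usubmx z)) z
    = col_mx (grad phi (usubmx z)) 0.
  rewrite -{1}(vsubmxK z) grad_col_mx; congr col_mx.
    by under eq_fun do rewrite col_mxKu.
  under eq_fun do rewrite col_mxKu.
  by apply/colP => k; rewrite !mxE derive_cst.
case: (split_ordP i) => l ->; last first.
  rewrite (_ : (fun z => grad _ z _ 0) = cst 0); first exact: cst_continuous.
  by apply/funext => z; rewrite gradE col_mxEd mxE.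
rewrite (_ : (fun z => grad _ z _ 0) = (fun z => grad phi (usubmx z) l 0)).
  move=> z; apply: (@continuous_comp _ _ _ (usubmx : 'cV[R]_(a + b) -> 'cV[R]_a)
    (fun w => grad phi w l 0)); first exact: continuous_usubmx.
  exact: C1_continuous_grad.
by apply/funext => z; rewrite gradE col_mxEu.
Qed.

(** The Lagrangian and its partial derivatives in [y], seen as functions of
    [z = (w, lam)] with [w = (x, y)], are all of this form. *)
Lemma C1_Lagrange_form a q (F : 'cV[R]_a -> R) (G : 'I_q -> 'cV[R]_a -> R) :
  C1 F -> (forall j, C1 (G j)) ->
  C1 (fun z : 'cV[R]_(a + q) =>
    F (usubmx z) - \sum_j G j (usubmx z) * dsubmx z j 0).
Proof.
move=> F1 G1; apply: C1_add; first exact: C1_usubmx.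
apply/C1_opp/C1_sum => j.
have lam1 : C1 (fun z : 'cV[R]_(a + q) => dsubmx z j 0).
  under eq_fun do rewrite mxE.
  exact: C1_coord.
exact: (C1_mul (C1_usubmx q (G1 j)) lam1).
Qed.

Lemma grad_Lagrange_form N q (F : 'cV[R]_N -> R) (G : 'I_q -> 'cV[R]_N -> R)
    (c : 'I_q -> R) w :
  differentiable F w -> (forall j, differentiable (G j) w) ->
  grad (fun w' => F w' - \sum_j G j w' * c j) w =
  grad F w - \sum_j c j *: grad (G j) w.
Proof.
move=> dF dG; apply/colP => i; rewrite !mxE.
rewrite (_ : (fun w' => _) = F - \sum_j c j \*: G j); last first.
  apply/funext => w'; rewrite !fctE fct_sumE; congr (_ - _).
  by apply: eq_bigr => j _; rewrite mulrC.
have dcG j v : derivable (c j \*: G j) w v.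
  by apply: derivableZ; exact: diff_derivable.
rewrite deriveB; last 2 first.
- exact: diff_derivable.
- exact: derivable_sum.
rewrite derive_sum// summxE; congr (_ - _); apply: eq_bigr => j _.
rewrite deriveZ ?mxE//; exact: diff_derivable.
Qed.

End C1.

(** * Convex functions and their critical points *)

Section Convexity.
Variable R : realType.

(** Weights in the interval type are replaced by a real number and its bounds,
    so that [t] can later tend to [0]. *)
Lemma convex_funP m (h : 'cV[R]_m -> R) :
  convex_fun h <-> forall (t : R) x y, 0 <= t <= 1 ->
    h (t *: x + (1 - t) *: y) <= t * h x + (1 - t) * h y.
Proof.
split=> [hc t x y t01|hc t x y _ _]; last first.
  by apply: hc; rewrite ge0/= le1.
have [t0 t1] := andP t01.
by have := hc (Itv01 t0 t1) x y; rewrite !inE; apply.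
Qed.

Lemma convex_fun_add m (h k : 'cV[R]_m -> R) :
  convex_fun h -> convex_fun k -> convex_fun (fun y => h y + k y).
Proof.
move=> /convex_funP hc /convex_funP kc; apply/convex_funP => t x y t01.
by rewrite !mulrDr addrACA lerD ?hc ?kc.
Qed.

Lemma convex_fun_scale m (c : R) (h : 'cV[R]_m -> R) :
  0 <= c -> convex_fun h -> convex_fun (fun y => h y * c).
Proof.
move=> c0 /convex_funP hc; apply/convex_funP => t x y t01.
by rewrite !mulrA -mulrDl ler_wpM2r ?hc.
Qed.

Lemma convex_fun_sum m k (h : 'I_k -> 'cV[R]_m -> R) :
  (forall j, convex_fun (h j)) -> convex_fun (fun y => \sum_j h j y).
Proof.
move=> hc; apply/convex_funP => t x y t01.
rewrite !mulr_sumr -big_split/=; apply: ler_sum => j _.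
by have /convex_funP := hc j; exact.
Qed.

(** Convexity bounds the difference quotient of [h] at [y] towards [y'] by
    [h y' - h y] for every step in [0, 1]; letting the step tend to [0] from the
    right bounds the directional derivative, which is [0] at a critical point. *)
Lemma convex_critical_min m (h : 'cV[R]_m -> R) y :
  convex_fun h -> differentiable h y -> grad h y = 0 -> forall y', h y <= h y'.
Proof.
move=> /convex_funP hc dh h0 y'; rewrite -subr_ge0.
have dv := derive_grad (y' - y) dh.
have : 'D_(y' - y) h y <= h y' - h y.
  have : derivable h y (y' - y) by exact: diff_derivable.
  rewrite /derivable /derive => cv.
  apply: (cvgr_to_le (cvg_dnbhs_at_right cv)).
  near=> t.
  have t0 : 0 < t by near: t; exact: nbhs_right_gt.
  have t1 : t <= 1 by near: t; exact: nbhs_right_le.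
  rewrite /= /GRing.scale/= ler_pdivrMl// lerBlDr.
  have -> : t *: (y' - y) + y = t *: y' + (1 - t) *: y.
    by rewrite scalerBr scalerBl scale1r addrAC addrA.
  rewrite (le_trans (hc _ _ _ _)) ?(ltW t0)//.
  by rewrite mulrBr mulrBl mul1r addrAC addrA.
by rewrite dv h0 /dot mulmx0 mxE.
Unshelve. all: by end_near. Qed.

End Convexity.

(** * Wolfe duality for the value function *)

Lemma dotNl (R : realType) p (a b : 'cV[R]_p) : dot (- a) b = - dot a b.
Proof. by rewrite /dot linearN mulNmx mxE. Qed.

Lemma dotNr (R : realType) p (a b : 'cV[R]_p) : dot a (- b) = - dot a b.
Proof. by rewrite /dot mulmxN mxE. Qed.

(** The Lagrangian and its partial derivatives in [y] are affine in [lam]; this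
    gives the block of their gradients that corresponds to [lam]. *)
Lemma derive_multiplier (R : realType) q (d : R) (c : 'I_q -> R)
    (lam : 'cV[R]_q) j :
  'D_(delta_mx j 0) (fun lam' : 'cV[R]_q => d - \sum_k c k * lam' k 0) lam
  = - c j.
Proof.
apply: derive_affine => h; rewrite mulrN -addrA -opprD; congr (_ - _).
rewrite (eq_bigr (fun k => c k * lam k 0 + h * (c k * (k == j)%:R))).
  rewrite big_split/= -mulr_sumr; congr (_ + h * _).
  rewrite (bigD1 j)//= eqxx mulr1 big1 ?addr0// => k /negPf ->.
  by rewrite mulr0.
by move=> k _; rewrite !mxE eqxx andbT mulrDr addrC mulrCA.
Qed.

Section WolfeDual.
Variables (R : realType) (n m q : nat).
Variables (f : 'cV[R]_(n + m) -> R) (g : 'cV[R]_(n + m) -> 'cV[R]_q).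

Definition dual_objective (z : 'cV[R]_(n + m + q)) : R :=
  Lagr f g (usubmx (usubmx z)) (dsubmx (usubmx z)) (dsubmx z).

Lemma dual_objectiveE x y lam :
  dual_objective (col_mx (col_mx x y) lam) = Lagr f g x y lam.
Proof. by rewrite /dual_objective !(col_mxKu, col_mxKd). Qed.

Lemma dualHE x y lam :
  dualH f g (col_mx (col_mx x y) lam) = nabla_y_L f g x y lam.
Proof. by rewrite /dualH !(col_mxKu, col_mxKd). Qed.

Lemma LagrE x y lam : Lagr f g x y lam =
  f (col_mx x y) - \sum_j g (col_mx x y) j 0 * lam j 0.
Proof.
rewrite /Lagr /dot mxE; congr (_ - _).
by apply: eq_bigr => j _; rewrite mxE.
Qed.

Lemma differentiable_Lagr_y x y lam :
  C1 f -> C1map g -> differentiable (fun y' => Lagr f g x y' lam) y.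
Proof.
move=> [df _] g1.
(* [col_mx x _] is the constant [col_mx x 0] plus a linear map. *)
rewrite (_ : (fun y' => _) =
    (f - \sum_j lam j 0 \*: (fun w => g w j 0)) \o
    (cst (col_mx x 0) + mulmx (col_mx 0 1%:M))).
  apply: differentiable_comp.
    apply: differentiableD; first exact: differentiable_cst.
    exact/linear_differentiable/continuous_mulmx.
  apply: differentiableB; first exact: df.
  apply: differentiable_sum => j; apply: differentiableZ.
  by have [dg _] := g1 j; exact: dg.
apply/funext => y'; rewrite LagrE /= !fctE fct_sumE.
rewrite mul_col_mx mul0mx mul1mx add_col_mx addr0 add0r.
by congr (_ - _); apply: eq_bigr => j _; rewrite mulrC.
Qed.

Lemma nabla_y_LE x y lam i : C1 f -> C1map g ->
  nabla_y_L f g x y lam i 0 = grad f (col_mx x y) (rshift n i) 0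
    - \sum_j grad (fun w => g w j 0) (col_mx x y) (rshift n i) 0 * lam j 0.
Proof.
move=> [df _] g1.
have dg j : differentiable (fun w => g w j 0) (col_mx x y).
  by have [dg _] := g1 j; exact: dg.
rewrite /nabla_y_L; under eq_fun do rewrite LagrE.
have := grad_Lagrange_form (fun j => lam j 0) (df _) dg.
rewrite grad_col_mx => /(congr1 dsubmx); rewrite col_mxKd => ->.
rewrite !mxE summxE; congr (_ - _).
by apply: eq_bigr => j _; rewrite !mxE mulrC.
Qed.

(** Dual feasibility makes [y] a maximizer of the concave function
    [Lagr x _ lam], which dominates [f (x, _)] on the feasible set since
    [g <= 0 <= lam] there. *)
Lemma weak_duality x y lam :
  concave_fun (fun y => f (col_mx x y)) ->
  (forall j, convex_fun (fun y => g (col_mx x y) j 0)) ->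
  C1 f -> C1map g -> nabla_y_L f g x y lam = 0 -> nonneg lam ->
  (V f g x <= (Lagr f g x y lam)%:E)%E.
Proof.
move=> fc gc f1 g1 crit lam0.
apply: ge_ereal_sup => _ [y' gy' <-]; rewrite lee_fin.
have dL := differentiable_Lagr_y x y lam f1 g1.
have Lmax : Lagr f g x y' lam <= Lagr f g x y lam.
  rewrite -lerN2; move: y' {gy'}; apply: convex_critical_min.
  - under eq_fun do rewrite LagrE opprB addrC.
    apply: convex_fun_add => //; apply: convex_fun_sum => j.
    exact: convex_fun_scale.
  - exact: differentiableN.
  - apply/colP => i; move/colP/(_ i) : crit; rewrite !mxE => crit.
    by rewrite deriveN ?crit ?oppr0//; exact: diff_derivable.
apply: le_trans Lmax; rewrite LagrE lerDl oppr_ge0.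
apply: sumr_le0 => j _; apply: mulr_le0_ge0 => //.
by have := gy' j; rewrite mxE oppr_ge0.
Qed.

Lemma C1_dual_objective : C1 f -> C1map g -> C1 dual_objective.
Proof.
move=> f1 g1.
rewrite (_ : dual_objective = fun z =>
    f (usubmx z) - \sum_j g (usubmx z) j 0 * dsubmx z j 0).
  exact: (C1_Lagrange_form f1 g1).
by apply/funext => z; rewrite /dual_objective LagrE vsubmxK.
Qed.

Lemma C1_dualH : C2 f -> C2map g -> C1map (dualH f g).
Proof.
move=> [f1 f2] g2 i.
have g1 : C1map g by move=> j; have [] := g2 j.
rewrite (_ : (fun z => _) = fun z =>
    grad f (usubmx z) (rshift n i) 0
    - \sum_j grad (fun w => g w j 0) (usubmx z) (rshift n i) 0
        * dsubmx z j 0).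
  apply: (@C1_Lagrange_form _ _ _ (fun w => grad f w (rshift n i) 0)
    (fun j w => grad (fun w => g w j 0) w (rshift n i) 0)); first exact: f2.
  by move=> j; have [_ dg1] := g2 j; exact: (dg1 (rshift n i)).
by apply/funext => z; rewrite /dualH nabla_y_LE// vsubmxK.
Qed.

Lemma C1_dualG : C1map (@dualG R n m q).
Proof.
move=> j; rewrite (_ : (fun z => _) =
    fun z : 'cV[R]_(n + m + q) => - z (rshift (n + m) j) 0).
  exact/C1_opp/C1_coord.
by apply/funext => z; rewrite !mxE.
Qed.

Lemma grad_dual_objective x y lam :
  grad dual_objective (col_mx (col_mx x y) lam) =
  col_mx (col_mx (nabla_x_L f g x y lam) (nabla_y_L f g x y lam))
         (- g (col_mx x y)).
Proof.
rewrite !grad_col_mx.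
under [X in grad X x]eq_fun do rewrite dual_objectiveE.
under [X in grad X y]eq_fun do rewrite dual_objectiveE.
apply: (congr1 (col_mx _)).
apply/colP => j; rewrite mxE [RHS]mxE.
under eq_fun do rewrite dual_objectiveE LagrE.
exact: derive_multiplier.
Qed.

Lemma nabla_dualH x y lam : C1 f -> C1map g ->
  nabla (dualH f g) (col_mx (col_mx x y) lam) =
  col_mx (col_mx (nabla_xy_L f g x y lam) (nabla_yy_L f g x y lam))
         (- (nabla_y_g g x y)^T).
Proof.
move=> f1 g1; rewrite !nabla_col_mx.
under [X in nabla X x]eq_fun do rewrite dualHE.
under [X in nabla X y]eq_fun do rewrite dualHE.
apply: (congr1 (col_mx _)).
apply/matrixP => j i; rewrite mxE.
under eq_fun do rewrite dualHE nabla_y_LE//.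
rewrite derive_multiplier !mxE delta_mx_dshift.
by rewrite -(derive_partiald (fun w => g w j 0)).
Qed.

Lemma nabla_dualG x y lam :
  nabla (@dualG R n m q) (col_mx (col_mx x y) lam) = col_mx 0 (- 1%:M).
Proof.
rewrite nabla_col_mx /dualG; congr col_mx; apply/matrixP => i j; rewrite !mxE.
  under eq_fun do rewrite col_mxKd mxE.
  by rewrite derive_cst.
apply: derive_affine => h; rewrite !col_mxKd !mxE.
by rewrite eqxx andbT opprD addrC mulrN [i == j]eq_sym.
Qed.

(** Weak duality transfers local minimality of [V] at [xb] to the Lagrangian:
    the two have the same value at the reference point, and the Lagrangian lies
    above [V] at dual feasible points whose [x] is in [X]. *)
Lemma dual_local_min (X : set 'cV[R]_n) xb yb lamb :
  (forall x, X x -> concave_fun (fun y : 'cV[R]_m => f (col_mx x y))) ->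
  (forall x, X x ->
     forall j, convex_fun (fun y : 'cV[R]_m => g (col_mx x y) j 0)) ->
  C1 f -> C1map g -> interior X xb -> local_min X (V f g) xb ->
  Sset f g xb yb -> Sigma f g xb yb lamb ->
  local_min (feasible (@dualG R n m q) (dualH f g)) dual_objective
    (col_mx (col_mx xb yb) lamb).
Proof.
move=> fc gc f1 g1 Xxb [_ xb_min] [_ fV] [crit [_ comp lam0]].
split.
  rewrite /feasible /= /dualG /dualH !(col_mxKu, col_mxKd).
  by split=> // i; rewrite opprK.
have VL : V f g xb = (dual_objective (col_mx (col_mx xb yb) lamb))%:E.
  rewrite /dual_objective !(col_mxKu, col_mxKd) -fV /Lagr.
  suff -> : dot (g (col_mx xb yb)) lamb = 0 by rewrite subr0.
  by apply: oppr_inj; rewrite oppr0 -dotNl.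
pose px (z : 'cV[R]_(n + m + q)) : 'cV[R]_n := usubmx (usubmx z).
have px_cont : continuous px.
  move=> z; apply: (@continuous_comp _ _ _
    (usubmx : 'cV[R]_(n + m + q) -> 'cV[R]_(n + m)) usubmx);
    exact: continuous_usubmx.
(* Interiority is what turns closeness of [x] to [xb] into [X x], on which both
   convexity and the minimality of [V] depend. *)
have : \forall x \near xb, X x /\ (V f g xb <= V f g x)%E.
  by near=> x; have Xx : X x; [near: x|split=> //; move: Xx; near: x].
have pxb : px (col_mx (col_mx xb yb) lamb) = xb by rewrite /px !col_mxKu.
rewrite -{1}pxb => /px_cont near_zb.
near=> z => -[lamz critz].
have [Xz Vz] : X (px z) /\ (V f g xb <= V f g (px z))%E by near: z.
rewrite -lee_fin -VL; apply: le_trans Vz _.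
apply: weak_duality => //; [exact: fc|exact: gc|].
by move=> j; have := lamz j; rewrite /dualG opprK.
Unshelve. all: by end_near. Qed.

End WolfeDual.

Theorem theorem4p3 (R : realType) (n m q : nat)
  (f : 'cV[R]_(n + m) -> R) (g : 'cV[R]_(n + m) -> 'cV[R]_q)
  (X : set 'cV[R]_n)
  (X_closed : closed X)
  (f_concave : forall x, X x -> concave_fun (fun y : 'cV[R]_m => f (col_mx x y)))
  (g_convex : forall x, X x ->
     forall j, convex_fun (fun y : 'cV[R]_m => g (col_mx x y) j 0))
  (f_C2 : C2 f) (g_C2 : C2map g)
  (xb : 'cV[R]_n) (yb : 'cV[R]_m) (lamb : 'cV[R]_q)
  (xb_int : interior X xb)
  (xb_min : local_min X (V f g) xb)
  (yb_sol : Sset f g xb yb)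
  (lamb_mult : Sigma f g xb yb lamb)
  (CQ : system_condition R)
  (CQ_qualifies : constraint_qualification CQ)
  (CQ_holds : CQ (n + m + q)%N q m (dualG (q := q)) (dualH f g)
                (col_mx (col_mx xb yb) lamb)) :
  exists ub : 'cV[R]_m,
    nabla_x_L f g xb yb lamb + nabla_xy_L f g xb yb lamb *m ub = 0 /\
    nabla_yy_L f g xb yb lamb *m ub = 0 /\
    nabla_y_L f g xb yb lamb = 0 /\
    complementary (- ((nabla_y_g g xb yb)^T *m ub) - g (col_mx xb yb)) lamb /\
    complementary (- g (col_mx xb yb)) lamb.
Proof.
have f1 : C1 f by case: f_C2.
have g1 : C1map g by move=> j; case: (g_C2 j).
have zb_min := dual_local_min f_concave g_convex f1 g1 xb_int xb_min yb_sol
  lamb_mult.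
have [crit compl] := lamb_mult; have [_ _ lam0] := compl.
have [a [b [a0 alam]]] := CQ_qualifies _ _ _ _ _ _ (@C1_dualG R n m q)
  (C1_dualH f_C2 g_C2) zb_min.1 CQ_holds _ (C1_dual_objective f1 g1) zb_min.
rewrite grad_dual_objective nabla_dualH// nabla_dualG !mul_col_mx.
rewrite mul0mx !add_col_mx addr0 add_col_mx => kkt.
have [kkt_xy kkt_lam] := eq_col_mx (etrans kkt (esym (col_mx0 _ _ _ _))).
have [kkt_x kkt_y] := eq_col_mx (etrans kkt_xy (esym (col_mx0 _ _ _ _))).
(* The [lam]-block of stationarity determines [a]. *)
have aE : a = - ((nabla_y_g g xb yb)^T *m b) - g (col_mx xb yb).
  rewrite -[LHS]addr0 -kkt_lam !mulNmx mul1mx.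
  by rewrite [- g _ + _]addrC -addrA addNKr addrC.
exists b; split; first by [].
split; first by move: kkt_y; rewrite crit add0r.
do 2!split=> //; rewrite -aE; split=> //.
by move: alam; rewrite /dualG col_mxKd dotNr -[in X in _ = X]oppr0 => /oppr_inj.
Qed.
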